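(* Let $(V,\varphi_V)$ and $(W,\varphi_W)$ be pointwise finite dimensional (PFD) persistence modules such that $(V,W)$ are $(\tau,\sigma)$-interleaved, and suppose that the maps $\tau$ and $\sigma$ are bijections. Then there is a matching $\mathcal{X}\colon\mathsf{PD}(V)\nrightarrow\mathsf{PD}(W)$ of undecorated persistence diagrams such that $\mathcal{X}([b,d,i])=[b',d',i']$ implies $$\sigma^{-1}(b)\le b'\le\tau(b)\quad\text{and}\quad\sigma^{-1}(d)\le d'\le\tau(d),$$ such that if $[b,d,i]\in\mathsf{PD}(V)$ is unmatched then $d\le(\sigma\circ\tau)(b)$, and if $[b',d',i']\in\mathsf{PD}(W)$ is not in $\operatorname{im}\mathcal{X}$ then $d'\le(\tau\circ\sigma)(b')$.
   Context: Fix a field $\mathsf{k}$; $\overline{\mathbb{R}}=\mathbb{R}\cup\{\pm\infty\}$. Monotone bijections $\mathbb{R}\to\mathbb{R}$ and their inverses are extended to $\overline{\mathbb{R}}$ by fixing $\pm\infty$. A persistence module $V=(V,\varphi_V)$ is a family of $\mathsf{k}$-vector spaces $\{V_t\}_{t\in\mathbb{R}}$ with linear maps $\varphi_V(s,t)\colon V_s\to V_t$ for $s\le t$ such that $\varphi_V(t,t)=\mathrm{id}$ and $\varphi_V(s,t)\circ\varphi_V(r,s)=\varphi_V(r,t)$ for $r\le s\le t$. It is PFD if every $V_t$ is finite-dimensional. A morphism $\phi\colon V\to W$ is a family of linear maps $\phi_t\colon V_t\to W_t$ with $\phi_t\circ\varphi_V(s,t)=\varphi_W(s,t)\circ\phi_s$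 for $s\le t$. Interleavings: a translation map is a monotone (non-decreasing) $\sigma\colon\mathbb{R}\to\mathbb{R}$ with $x\le\sigma(x)$ for all $x$. A translation pair is a pair $(\tau,\sigma)$ of monotone functions $\mathbb{R}\to\mathbb{R}$ such that $\tau\circ\sigma$ and $\sigma\circ\tau$ are translation maps. For $\sigma$ monotone, $V(\sigma)_t=V_{\sigma(t)}$ with $\varphi_{V(\sigma)}(s,t)=\varphi_V(\sigma(s),\sigma(t))$; for a morphism $\phi$, $\phi(\sigma)_t=\phi_{\sigma(t)}$. For a translation pair $(\tau,\sigma)$, $(V,W)$ is $(\tau,\sigma)$-interleaved if there are morphisms $\phi\colon V\to W(\tau)$, $\psi\colon W\to V(\sigma)$ with $\psi(\tau)_t\circ\phi_t=\varphi_V(t,(\sigma\circ\tau)(t))$ and $\phi(\sigma)_t\circ\psi_t=\varphi_W(t,(\tau\circ\sigma)(t))$ for all $t\in\mathbb{R}$. Undecorated persistence diagram: every PFD persistence module $V$ is a direct sum of interval modules $I_J$ ($J\subseteq\mathbb{R}$ a nonempty interval; $\mathsf{k}$ on $J$, $0$ elsewhere, identity maps within $J$), uniquely up to reindexing. $\mathsf{PD}(V)\subset\overline{\mathbb{R}}^2\times\mathbb{N}_{>0}$ is a set of points $[b,d,i]$ in bijection with the interval summands of $V$ (counted with multiplicity), where a summand $I_J$ corresponds to a point with $b=\inf J$, $d=\sup J$ (the index $i$ distinguishes points with equal $(b,d)$). A matching $\mathcal{X}\colon S\nrightarrow T$ is a relation that is the graph of an injective function $S'\to T'$, $S'\subseteq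 S$, $T'\subseteq T$; $\mathcal{X}(s)=t$ means $(s,t)\in\mathcal{X}$; its image is that of this function; points outside the domain/image are unmatched. *)

(* Defs.v *)
From HB Require Import structures.
From mathcomp Require Import all_boot all_order all_algebra.
From mathcomp Require Import all_classical all_reals ereal num_normedtype.

Set Implicit Arguments.
Unset Strict Implicit.
Unset Printing Implicit Defensive.

Import Order.TTheory GRing.Theory Num.Theory.
Local Open Scope classical_set_scope.
Local Open Scope ring_scope.

(* Direct sum of an arbitrary family of vector spaces: the finitely supported
   elements of the product. *)
Section DirectSumSpace.
Variables (k : fieldType) (A : Type) (M : A -> lmodType k).

Record dsum : Type := Dsum {
  dsum_val :> forall a, M a;
  dsum_fin : finite_set [set a | dsum_val a <> 0] }.

HB.instance Definition _ := gen_eqMixin dsum.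
HB.instance Definition _ := gen_choiceMixin dsum.

Lemma dsumP (f g : dsum) : (forall a, f a = g a) -> f = g.
Proof.
case: f g => [f hf] [g hg] /= fg.
have e : f = g by apply: functional_extensionality_dep.
by subst g; congr Dsum; exact: Prop_irrelevance.
Qed.

Lemma dsum_zero_fin : finite_set [set a | (0 : M a) <> 0].
Proof.
by rewrite (_ : [set a | _] = set0) //; apply/seteqP; split => a //= /(_ erefl).
Qed.
Definition dsum_zero := @Dsum (fun a => 0) dsum_zero_fin.

Lemma dsum_opp_fin (f : dsum) : finite_set [set a | - f a <> 0].
Proof.
apply: sub_finite_set (dsum_fin f) => a /= h e; apply: h.
by rewrite e oppr0.
Qed.
Definition dsum_opp f := Dsum (dsum_opp_fin f).

Lemma dsum_add_fin (f g : dsum) : finite_set [set a | f a + g a <> 0].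
Proof.
have /sub_finite_set : [set a | f a + g a <> 0] `<=`
    [set a | f a <> 0] `|` [set a | g a <> 0].
  move=> a /= h; case: (pselect (f a = 0)) => [e|]; [right|by left].
  by move=> e'; apply: h; rewrite e e' addr0.
by apply; rewrite finite_setU; split; exact: dsum_fin.
Qed.
Definition dsum_add f g := Dsum (dsum_add_fin f g).

Lemma dsum_scale_fin (c : k) (f : dsum) : finite_set [set a | c *: f a <> 0].
Proof.
apply: sub_finite_set (dsum_fin f) => a /= h e; apply: h.
by rewrite e scaler0.
Qed.
Definition dsum_scale c f := Dsum (dsum_scale_fin c f).

Lemma dsum_addA : associative dsum_add.
Proof. by move=> f g h; apply: dsumP => a /=; rewrite addrA. Qed.
Lemma dsum_addC : commutative dsum_add.
Proof. by move=> f g; apply: dsumP => a /=; rewrite addrC. Qed.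
Lemma dsum_add0 : left_id dsum_zero dsum_add.
Proof. by move=> f; apply: dsumP => a /=; rewrite add0r. Qed.
Lemma dsum_addN : left_inverse dsum_zero dsum_opp dsum_add.
Proof. by move=> f; apply: dsumP => a /=; rewrite addNr. Qed.

HB.instance Definition _ :=
  GRing.isZmodule.Build dsum dsum_addA dsum_addC dsum_add0 dsum_addN.

Lemma dsum_scaleA a b v : dsum_scale a (dsum_scale b v) = dsum_scale (a * b) v.
Proof. by apply: dsumP => i /=; rewrite scalerA. Qed.
Lemma dsum_scale1 : left_id 1 dsum_scale.
Proof. by move=> f; apply: dsumP => i /=; rewrite scale1r. Qed.
Lemma dsum_scaleDr : right_distributive dsum_scale +%R.
Proof. by move=> c f g; apply: dsumP => i /=; rewrite scalerDr. Qed.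
Lemma dsum_scaleDl v : {morph dsum_scale^~ v : a b / a + b}.
Proof. by move=> a b; apply: dsumP => i /=; rewrite scalerDl. Qed.

HB.instance Definition _ := GRing.Zmodule_isLmodule.Build k dsum
  dsum_scaleA dsum_scale1 dsum_scaleDr dsum_scaleDl.

End DirectSumSpace.

Section DirectSumMap.
Variables (k : fieldType) (A : Type) (M N : A -> lmodType k).
Variable f : forall a, {linear M a -> N a}.

Lemma dsum_map_fin (x : dsum M) : finite_set [set a | f a (x a) <> 0].
Proof.
apply: sub_finite_set (dsum_fin x) => a /= h e; apply: h.
by rewrite e linear0.
Qed.
Definition dsum_map (x : dsum M) : dsum N := Dsum (dsum_map_fin x).

Lemma dsum_map_linear : linear dsum_map.
Proof. by move=> c x y; apply: dsumP => a /=; rewrite linearP. Qed.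
HB.instance Definition _ :=
  GRing.isLinear.Build k (dsum M) (dsum N) _ dsum_map dsum_map_linear.
End DirectSumMap.

(* The structure maps are only given for s <= t; since s <= t is a boolean
   equation, the choice of its proof is irrelevant. *)
Record pmod (k : fieldType) (R : realType) := Pmod {
  pm_sp :> R -> lmodType k;
  pm_map : forall s t : R, s <= t -> {linear pm_sp s -> pm_sp t};
  pm_id : forall (t : R) (tt : t <= t) (x : pm_sp t), pm_map tt x = x;
  pm_comp : forall (r s t : R) (rs : r <= s) (st : s <= t) (rt : r <= t)
    (x : pm_sp r), pm_map st (pm_map rs x) = pm_map rt x }.

Section PersistenceModules.
Variables (k : fieldType) (R : realType).
Implicit Types V W : pmod k R.

Definition pfd V : Prop := forall t : R,
  exists (n : nat) (b : 'I_n -> V t),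
    forall x : V t, exists c : 'I_n -> k, x = \sum_(i < n) c i *: b i.

Record pmor V W := Pmor {
  pmor_map :> forall t : R, {linear V t -> W t};
  pmor_nat : forall (s t : R) (st : s <= t) (x : V s),
    pmor_map t (pm_map V st x) = pm_map W st (pmor_map s x) }.

Definition pisom V W : Prop :=
  exists (f : pmor V W) (g : pmor W V),
    (forall t, cancel (f t) (g t)) /\ (forall t, cancel (g t) (f t)).

Section Reindex.
Variables (f : R -> R) (fmono : {homo f : x y / x <= y}).

Definition preindex V : pmod k R :=
  @Pmod k R (fun t => V (f t)) (fun s t st => pm_map V (fmono st))
    (fun t tt x => pm_id (fmono tt) x)
    (fun r s t rs st rt x => pm_comp (fmono rs) (fmono st) (fmono rt) x).

Definition pmor_reindex V W (h : pmor V W) :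
    pmor (preindex V) (preindex W) :=
  @Pmor (preindex V) (preindex W) (fun t => h (f t))
    (fun s t st x => pmor_nat h (fmono st) x).
End Reindex.

Definition translation_map (f : R -> R) : Prop :=
  {homo f : x y / x <= y} /\ forall x, x <= f x.

Record translation_pair (tau sigma : R -> R) : Prop := TranslationPair {
  tp_mono1 : {homo tau : x y / x <= y};
  tp_mono2 : {homo sigma : x y / x <= y};
  tp_trans12 : translation_map (tau \o sigma);
  tp_trans21 : translation_map (sigma \o tau) }.

Definition interleaved tau sigma (p : translation_pair tau sigma) V W : Prop :=
  exists (phi : pmor V (preindex (tp_mono1 p) W))
         (psi : pmor W (preindex (tp_mono2 p) V)),
    (forall (t : R) (x : V t),
       pmor_reindex (tp_mono1 p) psi t (phi t x) =
       pm_map V ((tp_trans21 p).2 t) x) /\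
    (forall (t : R) (x : W t),
       pmor_reindex (tp_mono2 p) phi t (psi t x) =
       pm_map W ((tp_trans12 p).2 t) x).

Record ninterval := NInterval {
  ni_set :> set R;
  ni_nonempty : ni_set !=set0;
  ni_interval : is_interval ni_set }.

(* The space at t is k ^ [t \in J], i.e. k on J and 0 elsewhere; between two
   points of J, [pid_mx 1] is the 1 x 1 identity matrix, and otherwise it is
   an empty matrix. *)
Section IntervalModule.
Variable J : ninterval.

Definition interval_sp (t : R) : lmodType k := 'rV[k]_(t \in (J : set R)).
Definition interval_map (s t : R) (st : s <= t) : {linear interval_sp s -> interval_sp t} :=
  mulmxr (pid_mx 1).

Lemma interval_id (t : R) (tt : t <= t) (x : interval_sp t) : interval_map tt x = x.
Proof.
rewrite /interval_map /= -[RHS]mulmx1; congr (_ *m _).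
by case: (t \in _); [rewrite pid_mx_1 | apply/matrixP => -[]].
Qed.

Lemma interval_comp (r s t : R) (rs : r <= s) (st : s <= t) (rt : r <= t)
  (x : interval_sp r) : interval_map st (interval_map rs x) = interval_map rt x.
Proof.
rewrite /interval_map /= -mulmxA; congr (_ *m _).
have := @ni_interval J r t.
case: (boolP (r \in _)) => [/set_mem rJ|_]; last by move=> _; apply/matrixP => -[].
case: (boolP (t \in _)) => [/set_mem tJ|_]; last first.
  by move=> _; apply/matrixP => ? -[].
move=> /(_ rJ tJ s); rewrite rs st => /(_ isT)/mem_set ->.
by rewrite pid_mx_1 mulmx1.
Qed.

Definition interval_mod : pmod k R := Pmod interval_id interval_comp.
End IntervalModule.

Section DirectSum.
Variables (A : Type) (V : A -> pmod k R).

Definition direct_sum_sp (t : R) : lmodType k := dsum (fun a => V a t).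
Definition direct_sum_map (s t : R) (st : s <= t) : {linear direct_sum_sp s -> direct_sum_sp t} :=
  dsum_map (fun a => pm_map (V a) st).
Lemma direct_sum_id (t : R) (tt : t <= t) (x : direct_sum_sp t) : direct_sum_map tt x = x.
Proof. by apply: dsumP => a; exact: pm_id. Qed.
Lemma direct_sum_comp (r s t : R) (rs : r <= s) (st : s <= t) (rt : r <= t)
  (x : direct_sum_sp r) : direct_sum_map st (direct_sum_map rs x) = direct_sum_map rt x.
Proof. by apply: dsumP => a; exact: pm_comp. Qed.

Definition direct_sum : pmod k R := Pmod direct_sum_id direct_sum_comp.
End DirectSum.

(* A diagram point (b, d, i). *)
Definition dpoint : Type := (\bar R * \bar R * nat)%type.

(* D is an undecorated persistence diagram of V.  The diagram of V is
   determined up to the choice of the indices i. *)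
Definition persistence_diagram V (D : set dpoint) : Prop :=
  (forall p, D p -> (0 < p.2)%N) /\
  exists (A : Type) (J : A -> ninterval) (e : A -> dpoint),
    [/\ pisom V (direct_sum (fun a => interval_mod (J a))),
        set_bij [set: A] D e &
        forall a, (e a).1 = (ereal_inf (EFin @` J a), ereal_sup (EFin @` J a))].

Definition matching (S T : set dpoint) (X : set (dpoint * dpoint)) : Prop :=
  exists (S' T' : set dpoint) (f : dpoint -> dpoint),
    [/\ S' `<=` S, T' `<=` T, set_fun S' T' f, set_inj S' f &
        X = [set st | S' st.1 /\ f st.1 = st.2]].

Definition matching_dom (X : set (dpoint * dpoint)) : set dpoint :=
  [set s | exists t, X (s, t)].
Definition matching_im (X : set (dpoint * dpoint)) : set dpoint :=
  [set t | exists s, X (s, t)].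

End PersistenceModules.

(* Main.v *)
Require Import Defs.
From HB Require Import structures.
From mathcomp Require Import all_boot all_order all_algebra finmap.
From mathcomp Require Import all_classical all_reals ereal num_normedtype.

Import Order.TTheory GRing.Theory Num.Theory.
Local Open Scope classical_set_scope.
Local Open Scope ring_scope.

Set Implicit Arguments.
Unset Strict Implicit.
Unset Printing Implicit Defensive.

(** An interleaving of two direct sums of interval modules is a pair of matrices
    of scalars: the component of [phi] from an interval [I] of [V] to an interval
    [J] of [W] (reindexed by [tau]) is a scalar [F J I], which can be nonzero only
    if the endpoints satisfy [b_J <= tau b_I] and [d_J <= tau d_I]; similarly
    [psi] has scalars [G I' J], with [b_I' <= sigma b_J] and
    [d_I' <= sigma d_J].  Call [I] and [J] close when all four inequalities hold
    for them; these are the pairs that may be matched.  Call [I] long when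
    [rho b_I < d_I], with [rho] the composite of [tau] and [sigma]; these are the
    intervals that must be matched.

    Each long interval is close to finitely many intervals, because these all
    contain a common parameter ([close_finite]).  By Hall's theorem, in a form for
    infinite, locally finite graphs ([hall_matching]), the long intervals of [V]
    can be matched if every finite set [K] of them has at least as many neighbours
    as elements ([close_hall]).  To see this, consider the product [G * F] with
    rows and columns indexed by [K], in which the sum runs over the intervals [J]
    close to some element of [K].  If the sum ran over all [J], the relation
    [psi \o phi = shift] would give the Kronecker delta at each pair [I], [I']
    between which the shift has a component.  A nonzero contribution of some [J]
    that is close to neither [I] nor [I'], or of some [J] when there is no such
    component, forces [I'] to be strictly below [I] in a suitable order on pairs
    of endpoints ([far_below], [sum_coef_close]).  Hence the product is
    unitriangular, and it factors through the space spanned by the neighbours of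
    [K], which must have dimension at least the cardinality of [K].

    The order compares endpoints up to powers of [rho]: [I'] is below [I] if
    [b_I' <= rho^l b_I] and [d_I' <= rho^-l d_I] for some integer [l], with
    strictness conditions ([shift_lt]); it is a strict partial order even when
    [rho] has fixed points.

    Exchanging the roles of [V] and [W] gives a matching that covers the long
    intervals of [W].  The two matchings are merged by a Cantor-Bernstein argument
    into one that covers the long intervals on both sides. *)

(** * Linear dependence and minimal elements *)

(** A homogeneous linear system with fewer equations
    (indexed by [N]) than unknowns (indexed by [K]) has a nonzero solution. *)
Lemma nonzero_solution (k : fieldType) (A C : eqType) (K : seq A) (N : seq C)
    (F : C -> A -> k) :
  uniq K -> (size N < size K)%N ->
  exists x : A -> k, (exists2 a, a \in K & x a != 0) /\
    forall c, c \in N -> \sum_(a <- K) x a * F c a = 0.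
Proof.
move=> uK sNK.
pose M := \matrix_(i < size K, j < size N)
  F (tnth (in_tuple N) j) (tnth (in_tuple K) i).
have : kermx M != 0.
  rewrite -mxrank_eq0 mxrank_ker subn_eq0 -ltnNge.
  exact: leq_ltn_trans (rank_leq_col M) sNK.
case/rowV0Pn => v /sub_kermxP vM /rV0Pn[i vi].
pose x a := if insub (index a K) is Some i then v 0 i else 0.
have xE j : x (tnth (in_tuple K) j) = v 0 j.
  rewrite /x (tnth_nth (tnth (in_tuple K) j)) /= index_uniq //.
  by rewrite valK.
exists x; split.
  by exists (tnth (in_tuple K) i); [exact: mem_tnth | rewrite xE].
move=> c cN; have /tnthP[j ->] : c \in in_tuple N by [].
rewrite big_tnth -[RHS](_ : (v *m M) 0 j = 0); last by rewrite vM mxE.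
by rewrite mxE; apply: eq_bigr => i' _; rewrite mxE xE.
Qed.

(** A finite nonempty set has a maximal element for a strict partial order. *)
Lemma exists_maximal (T : eqType) (r : T -> T -> Prop) (s : seq T) (x : T) :
  (forall a, ~ r a a) -> (forall a b c, r a b -> r b c -> r a c) ->
  x \in s -> exists2 m, m \in s & forall y, y \in s -> ~ r m y.
Proof.
move=> irr tr; elim: s x => [//|a [|b s] IH] x _.
  exists a; first exact: mem_head.
  by move=> y; rewrite inE => /eqP ->.
have [m ms mP] := IH b (mem_head _ _).
case: (pselect (r m a)) => [ma|nma].
  exists a; first exact: mem_head.
  move=> y; rewrite inE => /orP[/eqP -> //|ys ay].
  exact: mP ys (tr _ _ _ ma ay).
exists m; first by rewrite inE ms orbT.
by move=> y; rewrite inE => /orP[/eqP -> //|]; exact: mP.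
Qed.

(** * Matchings in bipartite graphs *)

(** A matching between two types, as a relation; in contrast to a function,
    this makes sense when the target is empty. *)
Definition partial_injection (A C : Type) (M : A -> C -> Prop) : Prop :=
  (forall a c c', M a c -> M a c' -> c = c') /\
  (forall a a' c, M a c -> M a' c -> a = a').

Section Hall.
Variables (A C : choiceType) (P : set A).
Local Open Scope fset_scope.
Implicit Types (N M : A -> {fset C}) (K : {fset A}).

(** The union of the neighbourhoods of the vertices in [K]. *)
Definition nbhds N K : {fset C} := \bigcup_(a <- K) N a.

(** Hall's condition for the vertices in [P]; [N a] is the finite set of the
    vertices to which [a] may be matched. *)
Definition hall_condition N : Prop :=
  forall K, (forall a, a \in K -> P a) -> (#|` K| <= #|` nbhds N K|)%N.

Lemma nbhdsP N K c :
  reflect (exists2 a, a \in K & c \in N a) (c \in nbhds N K).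
Proof.
apply: (iffP (bigfcupP _ _ _ _)) => [[a]|[a aK cN]].
  by rewrite andbT => aK cN; exists a.
by exists a; rewrite ?andbT.
Qed.

(** In a chain of families satisfying Hall's condition the intersection
    satisfies it too, since on a finite set of vertices it is attained. *)
Lemma hall_chain (S : set (A -> {fset C})) (N : A -> {fset C}) :
  (forall M, S M -> hall_condition M /\ forall a, M a `<=` N a) ->
  (forall M M', S M -> S M' ->
     (forall a, M a `<=` M' a) \/ (forall a, M' a `<=` M a)) ->
  S !=set0 ->
  hall_condition (fun a => [fset c in N a | `[< forall M, S M -> c \in M a >]]).
Proof.
set I := (X in hall_condition X) => SN tot [M0 SM0] K KP.
have IP M a c : S M -> c \in I a -> c \in M a.
  by move=> SM; rewrite !inE /= => /andP[_ /asboolP]; apply.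
(* For one vertex, a member of least cardinality attains the intersection. *)
have attained1 a : exists2 M, S M & M a `<=` I a.
  have [n] : exists n, exists2 M, S M & #|` M a| = n by exists #|` M0 a|, M0.
  elim/ltn_ind: n => n IH [M SM Mn].
  case: (pselect (exists2 M', S M' & (#|` M' a| < n)%N)) => [[M' SM' lt]|no].
    exact: (IH _ lt (ex_intro2 _ _ M' SM' erefl)).
  exists M => //; apply/fsubsetP => c cM; rewrite !inE /=.
  have [_ /(_ a)/fsubsetP/(_ c cM) ->] := SN _ SM.
  apply/asboolP => M' SM'; case: (tot _ _ SM SM') => /(_ a) sub.
    exact: (fsubsetP sub).
  have /eqP -> // : M' a == M a.
  rewrite eqEfcard sub Mn leqNgt; apply/negP => lt.
  by apply: no; exists M'.
have [M SM MI] : exists2 M, S M & forall a, a \in K -> M a `<=` I a.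
  suff H (s : seq A) : exists2 M, S M & forall a, a \in s -> M a `<=` I a.
    exact: H.
  elim: s => [|a s [M SM IH]]; first by exists M0.
  have [M' SM' M'I] := attained1 a.
  case: (tot _ _ SM SM') => sub; [exists M|exists M'] => // b.
    rewrite inE => /orP[/eqP ->|]; last exact: IH.
    exact: fsubset_trans (sub a) M'I.
  rewrite inE => /orP[/eqP -> //|bs].
  exact: fsubset_trans (sub b) (IH b bs).
have [HM _] := SN _ SM.
apply: leq_trans (HM K KP) _; apply: fsubset_leq_card.
apply/fsubsetP => c /nbhdsP[a aK cM]; apply/nbhdsP; exists a => //.
exact: (fsubsetP (MI a aK)).
Qed.

(** Zorn's lemma gives a family that is minimal with Hall's condition. *)
Lemma hall_minimal N : hall_condition N ->
  exists M, [/\ hall_condition M, forall a, M a `<=` N a &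
    forall M', hall_condition M' -> (forall a, M' a `<=` M a) -> M' = M].
Proof.
move=> HN.
pose Q (M : A -> {fset C}) : bool := `[< hall_condition M /\ forall a, M a `<=` N a >].
pose T := {M : A -> {fset C} | Q M}.
pose ge (s t : T) := `[< forall a, sval t a `<=` sval s a >].
have [|||S tot|[M QM] Mmax] := @Zorn T ge.
- by move=> s; apply/asboolP => a.
- move=> r s t /asboolP rs /asboolP st; apply/asboolP => a.
  exact: fsubset_trans (st a) (rs a).
- move=> [s Qs] [t Qt] /asboolP /= st /asboolP /= ts; apply: eq_exist.
  by apply/funext => a; apply/eqP; rewrite eqEfsubset st ts.
- case: (pselect (S !=set0)) => [[s0 Ss0]|S0]; last first.
    have QN : Q N by apply/asboolP.
    by exists (exist _ N QN) => s Ss; case: S0; exists s.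
  pose S' := [set M : A -> {fset C} | exists2 s, S s & M = sval s].
  pose I a := [fset c in N a | `[< forall M, S' M -> c \in M a >]].
  have QI : Q I.
    apply/asboolP; split; last by move=> a; apply: fset_sub.
    apply: hall_chain.
    + by move=> _ [[M /= /asboolP QM] _ ->].
    + move=> _ _ [s Ss ->] [t St ->].
      by case: (tot _ _ Ss St) => /asboolP; [right|left].
    + by exists (sval s0), s0.
  exists (exist _ I QI) => s Ss; apply/asboolP => a /=.
  apply/fsubsetP => c; rewrite !inE /= => /andP[_ /asboolP]; apply.
  by exists s.
have /asboolP[HM MN] := QM.
exists M; split => // M' HM' M'M.
have QM' : Q M'.
  by apply/asboolP; split => // a; apply: fsubset_trans (M'M a) (MN a).
have E : exist Q M' QM' = exist Q M QM by apply: Mmax; apply/asboolP.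
exact: (congr1 sval E).
Qed.

(** In a minimal family the neighbourhoods are at most singletons: if [x] and
    [y] could both not be removed from [M a], the two obstructions would
    contradict Hall's condition by submodularity of the cardinality. *)
Lemma hall_minimal_unique M a x y : hall_condition M ->
  (forall M', hall_condition M' -> (forall a, M' a `<=` M a) -> M' = M) ->
  P a -> x \in M a -> y \in M a -> x = y.
Proof.
move=> HM min Pa xM yM; apply/eqP/negPn/negP => xy.
(* A set that violates Hall's condition once [z] is removed has to contain [a];
   [L] is the rest of it. *)
have obstruction z : z \in M a -> exists L : {fset A},
    [/\ a \notin L, forall b, b \in L -> P b &
        (#|` nbhds M L `|` (M a `\ z)| <= #|` L|)%N].
  move=> zM; pose Mz b := if b == a then M a `\ z else M b.
  have nH : ~ hall_condition Mz.
    move=> HMz; have /(congr1 (fun f => z \in f a)) : Mz = M.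
      apply: min => // b; rewrite /Mz; case: eqP => [->|_] //.
      exact: fsubD1set.
    by rewrite /Mz eqxx !inE eqxx zM.
  have [K /not_implyP[KP]] : exists K, ~ ((forall a, a \in K -> P a) ->
      (#|` K| <= #|` nbhds Mz K|)%N) by apply/existsNP.
  move/negP; rewrite -ltnNge => lt.
  have aK : a \in K.
    apply/negPn/negP => aK; move: lt; rewrite ltnNge; apply/negP/negPn.
    rewrite (_ : nbhds Mz K = nbhds M K); first exact: HM.
    apply: eq_big_seq => b bK; rewrite /Mz; case: eqP => // ba.
    by rewrite -ba bK in aK.
  exists (K `\ a); split; first by rewrite !inE eqxx.
    by move=> b; rewrite !inE => /andP[_]; exact: KP.
  rewrite -ltnS; move: lt; rewrite (cardfsD1 a K) aK add1n.
  apply: leq_trans; rewrite ltnS; apply: fsubset_leq_card.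
  apply/fsubsetP => c; rewrite inE => /orP[/nbhdsP[b]|cz].
    rewrite !inE => /andP[ba bK] cb; apply/nbhdsP; exists b => //.
    by rewrite /Mz (negbTE ba).
  by apply/nbhdsP; exists a => //; rewrite /Mz eqxx.
have [L1 [aL1 PL1 c1]] := obstruction x xM.
have [L2 [aL2 PL2 c2]] := obstruction y yM.
set X := _ `|` _ in c1; set Y := _ `|` _ in c2.
have cU : (#|` L1 `|` L2|.+1 <= #|` X `|` Y|)%N.
  have -> : #|` L1 `|` L2|.+1 = #|` a |` (L1 `|` L2)|.
    by rewrite cardfsU1 inE negb_or aL1 aL2.
  apply: leq_trans (HM _ _) _.
    move=> b; rewrite !inE => /orP[/eqP -> //|/orP[]]; [exact: PL1|exact: PL2].
  apply: fsubset_leq_card; apply/fsubsetP => c /nbhdsP[b].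
  rewrite !inE => /orP[/eqP ->|/orP[bL|bL]] cM.
  - case: (eqVneq c x) => [->|cx]; first by rewrite xy xM !orbT.
    by rewrite cM !orbT.
  - by rewrite (_ : c \in nbhds M L1) //; apply/nbhdsP; exists b.
  - by rewrite (_ : c \in nbhds M L2) ?orbT //; apply/nbhdsP; exists b.
have cI : (#|` L1 `&` L2| <= #|` X `&` Y|)%N.
  apply: leq_trans (HM _ _) _; first by move=> b; rewrite inE => /andP[/PL1].
  apply: fsubset_leq_card; apply/fsubsetP => c /nbhdsP[b].
  rewrite inE => /andP[b1 b2] cM.
  by rewrite in_fsetI; apply/andP; split; rewrite in_fsetU; apply/orP; left;
    apply/nbhdsP; exists b.
have := leq_add cU cI; rewrite addSn !cardfsUI => lt.
by have := leq_trans lt (leq_add c1 c2); rewrite ltnn.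
Qed.

(** Hall's theorem for possibly infinite, locally finite bipartite graphs. *)
Lemma hall_matching N : hall_condition N ->
  exists M : A -> C -> Prop, [/\ partial_injection M,
    forall a c, M a c -> P a /\ c \in N a & forall a, P a -> exists c, M a c].
Proof.
move=> HN; have [M [HM MN min]] := hall_minimal HN.
have uniq := hall_minimal_unique HM min.
exists (fun a c => P a /\ c \in M a); split.
- split=> [a c c' [Pa cM] [_ cM']|a a' c [Pa cM] [Pa' cM']]; first exact: uniq cM'.
  apply/eqP/negPn/negP => aa'.
  have := HM [fset a; a'] _; rewrite cardfs2 aa' => card2.
  suff : (2 <= #|` [fset c]|)%N by rewrite cardfs1.
  apply: leq_trans (card2 _) _; first by move=> b; rewrite !inE => /orP[] /eqP ->.
  apply: fsubset_leq_card; apply/fsubsetP => d /nbhdsP[b].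
  by rewrite !inE => /orP[] /eqP -> dM; apply/eqP; [apply: (uniq a)|apply: (uniq a')].
- by move=> a c [Pa cM]; split => //; exact: (fsubsetP (MN a)).
- move=> a Pa; have := HM [fset a] _; rewrite cardfs1 cardfs_gt0 => ne.
  have /fset0Pn[c /nbhdsP[b]] : nbhds M [fset a] != fset0.
    by apply: ne => b; rewrite inE => /eqP ->.
  by rewrite inE => /eqP -> cM; exists c.
Qed.

End Hall.

(** A matching from [A] to [C] and one from [C] to [A] can be merged into one
    that covers the domains of both, as in the Cantor-Bernstein theorem
    (for finite graphs this is the theorem of Mendelsohn and Dulmage). *)
Section Merge.
Variables (A C : Type) (f : A -> C -> Prop) (g : C -> A -> Prop).

(** The vertices whose alternating path, followed backwards, starts in [A]. *)
Inductive from_source : A -> Prop :=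
| from_source0 a : (forall c, ~ g c a) -> from_source a
| from_sourceS a c a' : from_source a -> f a c -> g c a' -> from_source a'.

(** Follow [f] on these vertices and [g] backwards on the others. *)
Definition merge (a : A) (c : C) : Prop :=
  (from_source a /\ f a c) \/ (~ from_source a /\ g c a).

Lemma merge_injection :
  partial_injection f -> partial_injection g -> partial_injection merge.
Proof.
move=> [f1 f2] [g1 g2]; split.
  by move=> a c c' [[sa fa]|[sa ga]] [[sa' fa']|[sa' ga']] //;
    [exact: f1 fa fa'|exact: g2 ga ga'].
move=> a a' c [[sa fa]|[sa ga]] [[sa' fa']|[sa' ga']].
- exact: f2 fa fa'.
- by case: sa'; exact: from_sourceS sa fa ga'.
- by case: sa; exact: from_sourceS sa' fa' ga.
- exact: g1 ga ga'.
Qed.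

Lemma merge_covers_left a c : f a c -> exists c', merge a c'.
Proof.
move=> fac; case: (pselect (from_source a)) => [sa|nsa].
  by exists c; left.
have [c' /contrapT gc'] : exists c', ~ ~ g c' a.
  by apply/existsNP => ng; apply: nsa; exact: from_source0.
by exists c'; right.
Qed.

Lemma merge_covers_right c a :
  partial_injection g -> g c a -> exists a', merge a' c.
Proof.
move=> [_ g2] gca; case: (pselect (from_source a)) => [sa|nsa]; last first.
  by exists a; right.
case: sa gca => [{}a ng /ng //|a' c' {}a sa' fa' gc' gca].
by exists a'; left; rewrite (g2 _ _ _ gca gc').
Qed.

End Merge.

(** * The shift order on pairs of endpoints *)

(** The shift [rho] is an order embedding with [x <= rho x]; it may have fixed
    points. *)
Section ShiftOrder.
Variables (disp : Order.disp_t) (T : orderType disp) (rho : T -> T).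
Hypothesis rho_mono : {mono rho : x y / (x <= y)%O}.
Hypothesis rho_ge : forall x, (x <= rho x)%O.

Lemma iter_mono n : {mono iter n rho : x y / (x <= y)%O}.
Proof. by elim: n => // n IH x y; rewrite /= rho_mono IH. Qed.

Lemma iter_lt_mono n : {mono iter n rho : x y / (x < y)%O}.
Proof. exact: leW_mono (iter_mono n). Qed.

Lemma iter_ge n m x : (n <= m)%N -> (iter n rho x <= iter m rho x)%O.
Proof.
move=> /subnKC <-; elim: (m - n)%N => [|l IH]; first by rewrite addn0.
by rewrite addnS /=; exact: le_trans IH (rho_ge _).
Qed.

(** The pair [q] of endpoints is below [p] if, for some integer [l = n - m],
    the left endpoint of [q] is at most [rho^l] of that of [p] and the right
    endpoint of [q] is at most [rho^-l] of that of [p].  The strictness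
    conditions exclude the degenerate case where endpoints are fixed by [rho];
    with them this is a strict partial order. *)
Definition shift_lt (q p : T * T) : Prop :=
  exists n m,
    [/\ (iter m rho q.1 <= iter n rho p.1)%O,
        (iter n rho q.2 <= iter m rho p.2)%O,
        (n <= m)%N -> (iter m rho q.1 < iter n rho p.1)%O &
        (m <= n)%N -> (iter n rho q.2 < iter m rho p.2)%O].

Lemma shift_lt_irr p : ~ shift_lt p p.
Proof.
move=> [n [m [_ _ nm mn]]]; case/orP: (leq_total n m) => le.
  by have := nm le; rewrite ltNge iter_ge.
by have := mn le; rewrite ltNge iter_ge.
Qed.

Lemma shift_lt_trans r q p : shift_lt r q -> shift_lt q p -> shift_lt r p.
Proof.
have iterC i j x : iter i rho (iter j rho x) = iter j rho (iter i rho x).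
  by rewrite -!iterD addnC.
have comp x y z i j i' j' :
    (iter j' rho x <= iter i' rho y)%O -> (iter j rho y <= iter i rho z)%O ->
    (iter (j + j') rho x <= iter (i + i') rho z)%O.
  move=> xy yz; rewrite addnC [(i + i')%N]addnC !iterD iterC.
  apply: (@le_trans _ _ (iter j rho (iter i' rho y))); first by rewrite iter_mono.
  by rewrite iterC iter_mono.
have compl x y z i j i' j' :
    (iter j' rho x < iter i' rho y)%O -> (iter j rho y <= iter i rho z)%O ->
    (iter (j + j') rho x < iter (i + i') rho z)%O.
  move=> xy yz; rewrite addnC [(i + i')%N]addnC !iterD iterC.
  apply: (@lt_le_trans _ _ (iter j rho (iter i' rho y))).
    by rewrite iter_lt_mono.
  by rewrite iterC iter_mono.
have compr x y z i j i' j' :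
    (iter j' rho x <= iter i' rho y)%O -> (iter j rho y < iter i rho z)%O ->
    (iter (j + j') rho x < iter (i + i') rho z)%O.
  move=> xy yz; rewrite addnC [(i + i')%N]addnC !iterD iterC.
  apply: (@le_lt_trans _ _ (iter j rho (iter i' rho y))).
    by rewrite iter_mono.
  by rewrite iterC iter_lt_mono.
move=> [n' [m' [rq1 rq2 rqn rqm]]] [n [m [qp1 qp2 qpn qpm]]].
exists (n + n')%N, (m + m')%N; split.
- exact: comp rq1 qp1.
- exact: comp rq2 qp2.
- move=> le; case: (leqP n m) => [/qpn|lt]; first exact: compr rq1.
  apply: compl qp1; apply: rqn; rewrite leqNgt; apply/negP => lt'.
  by have := leq_add (ltnW lt) lt'; rewrite addnS ltnNge le.
- move=> le; case: (leqP m n) => [/qpm|lt]; first exact: compr rq2.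
  apply: compl qp2; apply: rqm; rewrite leqNgt; apply/negP => lt'.
  by have := leq_add (ltnW lt) lt'; rewrite addnS ltnNge le.
Qed.

End ShiftOrder.

(** * Endpoints of intervals and increasing bijections *)

(** [f] is a monotone bijection of the real line with inverse [g]. *)
Definition monotone_bijection (R : realType) (f g : R -> R) : Prop :=
  [/\ {homo f : x y / x <= y}, cancel f g & cancel g f].

Section MonotoneBijection.
Variables (R : realType) (f g : R -> R).
Hypothesis fg : monotone_bijection f g.

Lemma monotone_bijection_le : {mono f : x y / x <= y}.
Proof.
case: fg => fle fK gK x y; apply/idP/idP => [|/fle //].
rewrite !leNgt; apply: contra => yx.
have := fle _ _ (ltW yx); rewrite le_eqVlt => /orP[/eqP e|//].
by move: yx; rewrite -(fK x) -(fK y) e ltxx.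
Qed.

Lemma er_map_le : {mono er_map f : x y / (x <= y)%E}.
Proof.
move=> [x||] [y||]; rewrite /= ?leey ?leNye //.
by rewrite !lee_fin monotone_bijection_le.
Qed.

Lemma er_map_lt : {mono er_map f : x y / (x < y)%E}.
Proof. exact: leW_mono er_map_le. Qed.

Lemma er_mapK : cancel (er_map f) (er_map g).
Proof. by case: fg => _ fK _ [x||] //=; rewrite fK. Qed.

Lemma monotone_bijection_inv : monotone_bijection g f.
Proof.
case: fg => fle fK gK; split=> // x y xy.
by rewrite -monotone_bijection_le !gK.
Qed.

End MonotoneBijection.

Lemma monotone_bijection_comp (R : realType) (f g f' g' : R -> R) :
  monotone_bijection f g -> monotone_bijection f' g' ->
  monotone_bijection (f \o f') (g' \o g).
Proof.
move=> [fle fK gK] [fle' fK' gK']; split.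
- by move=> x y xy; exact/fle/fle'.
- exact: can_comp fK fK'.
- exact: can_comp gK' gK.
Qed.

Lemma er_map_le_swap (R : realType) (f g : R -> R) x y :
  monotone_bijection f g -> (er_map g x <= y)%E = (x <= er_map f y)%E.
Proof.
move=> fg; rewrite -(er_map_le fg).
by rewrite (er_mapK (monotone_bijection_inv fg)).
Qed.

Lemma er_map_lt_swap (R : realType) (f g : R -> R) x y :
  monotone_bijection f g -> (x < er_map g y)%E = (er_map f x < y)%E.
Proof. by move=> fg; rewrite !ltNge (er_map_le_swap _ _ fg). Qed.

Lemma er_map_comp (R : realType) (f g : R -> R) x :
  er_map (f \o g) x = er_map f (er_map g x).
Proof. by case: x. Qed.

Lemma exists_real_between (R : realType) (x y : \bar R) :
  (x < y)%E -> exists t : R, (x < t%:E < y)%E.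
Proof.
case: x => [x||]; case: y => [y||] //=.
- rewrite lte_fin => xy; exists ((x + y) / 2).
  by rewrite !lte_fin !midf_lt.
- by move=> _; exists (x + 1); rewrite lte_fin ltrDl ltr01 ltry.
- by move=> _; exists (y - 1); rewrite lte_fin ltrBlDr ltrDl ltr01 ltNyr.
- by move=> _; exists 0; rewrite ltNyr ltry.
Qed.

Section Endpoints.
Variable R : realType.
Implicit Types I J : set R.

(** The endpoints of an interval, as extended reals. *)
Definition birth I : \bar R := ereal_inf (EFin @` I).
Definition death I : \bar R := ereal_sup (EFin @` I).

Lemma birth_le I t : I t -> (birth I <= t%:E)%E.
Proof. by move=> It; apply: ereal_inf_lbound; exists t. Qed.

Lemma le_death I t : I t -> (t%:E <= death I)%E.
Proof. by move=> It; apply: ereal_sup_ubound; exists t. Qed.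

Lemma interval_between I t :
  is_interval I -> (birth I < t%:E)%E -> (t%:E < death I)%E -> I t.
Proof.
move=> itvI /ereal_inf_lt[_ [x Ix <-]] xt /ereal_sup_gt[_ [y Iy <-]] ty.
apply: (itvI x y) => //; move: xt ty.
by rewrite !lte_fin => /ltW -> /ltW ->.
Qed.

Variables (f g : R -> R).
Hypothesis fg : monotone_bijection f g.

(** It is enough to compare the two sets to the left of a common parameter. *)
Lemma birth_le_map I J t : I t -> (forall s, s <= t -> I s -> J (f s)) ->
  (birth J <= er_map f (birth I))%E.
Proof.
move=> It IJ; rewrite -(er_map_le_swap _ _ fg).
apply/ereal_infP => _ [s Is <-]; rewrite (er_map_le_swap _ _ fg) /=.
have [st|/ltW ts] := leP s t; first exact/birth_le/IJ.
apply: le_trans (birth_le (IJ _ (lexx t) It)) _.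
by rewrite lee_fin (monotone_bijection_le fg).
Qed.

(** Dually, to the right of a common parameter. *)
Lemma death_le_map I J t : J (f t) -> (forall s, t <= s -> J (f s) -> I s) ->
  (death J <= er_map f (death I))%E.
Proof.
move=> Jt JI; apply/ereal_supP => _ [s Js <-].
have fK := er_mapK (monotone_bijection_inv fg) s%:E.
rewrite -fK (er_map_le fg) /=; have [ts|/ltW st] := leP t (g s).
  by apply/le_death/JI => //; case: fg => _ _ ->.
apply: (@le_trans _ _ t%:E); first by rewrite lee_fin.
exact/le_death/JI.
Qed.

End Endpoints.

(** * Bases adapted to an interval decomposition *)

(** A frame packages a decomposition of [V] into interval modules with
    supports [I a], in terms of elements: the generators [fr_gen a t] of the
    summands (zero outside [I a]), the dual coordinates [fr_coord a t], and the
    finite set [fr_idx t] of the summands alive at [t]. *)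
Record frame (k : fieldType) (R : realType) (V : pmod k R) (A : choiceType)
    (I : A -> set R) := Frame {
  fr_gen : A -> forall t, V t;
  fr_coord : A -> forall t, {linear V t -> k^o};
  fr_idx : R -> {fset A};
  fr_gen_map : forall a s t (st : s <= t), I a s ->
    pm_map V st (fr_gen a s) = fr_gen a t;
  fr_coord_map : forall a s t (st : s <= t) x, I a t ->
    fr_coord a t (pm_map V st x) = fr_coord a s x;
  fr_coord_gen : forall a a' t, I a t ->
    fr_coord a' t (fr_gen a t) = (a' == a)%:R;
  fr_idxP : forall a t, a \in fr_idx t <-> I a t;
  fr_expand : forall t x,
    x = \sum_(a <- fr_idx t) fr_coord a t x *: fr_gen a t;
  fr_gen_out : forall a t, ~ I a t -> fr_gen a t = 0;
  fr_coord_out : forall a t x, ~ I a t -> fr_coord a t x = 0 }.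

Definition frame_preindex (k : fieldType) (R : realType) (V : pmod k R)
    (A : choiceType) (I : A -> set R) (f : R -> R)
    (fle : {homo f : x y / x <= y}) (F : frame V I) :
    frame (preindex fle V) (fun a => f @^-1` I a) :=
  @Frame k R (preindex fle V) A (fun a => f @^-1` I a)
    (fun a t => fr_gen F a (f t)) (fun a t => fr_coord F a (f t))
    (fun t => fr_idx F (f t))
    (fun a s t st => @fr_gen_map _ _ _ _ _ F a _ _ (fle s t st))
    (fun a s t st => @fr_coord_map _ _ _ _ _ F a _ _ (fle s t st))
    (fun a a' t => @fr_coord_gen _ _ _ _ _ F a a' (f t))
    (fun a t => @fr_idxP _ _ _ _ _ F a (f t))
    (fun t => @fr_expand _ _ _ _ _ F (f t))
    (fun a t => @fr_gen_out _ _ _ _ _ F a (f t))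
    (fun a t => @fr_coord_out _ _ _ _ _ F a (f t)).

(** The matrix entries of a morphism: the component of [h] from the summand [a]
    of [V] to the summand [c] of [W] is multiplication by a scalar. *)
Section MorphismCoef.
Variables (k : fieldType) (R : realType) (V W : pmod k R).
Variables (A C : choiceType) (I : A -> set R) (J : C -> set R).
Variables (FV : frame V I) (FW : frame W J) (h : pmor V W).

Definition coef_at t c a : k := fr_coord FW c t (h t (fr_gen FV a t)).

(** The value of [coef_at] does not depend on the parameter, as long as both
    summands are alive there ([coef_atE]).  If they are never alive together, the
    default parameter gives 0. *)
Definition coef c a : k := coef_at (xget 0 (I a `&` J c)) c a.

Lemma coef_at_le s t c a : s <= t -> I a s -> J c t ->
  coef_at t c a = coef_at s c a.
Proof.
move=> st Is Jt; rewrite /coef_at -(fr_gen_map FV st Is) pmor_nat.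
by rewrite fr_coord_map.
Qed.

Lemma coef_at_neq0 t c a : coef_at t c a != 0 -> I a t /\ J c t.
Proof.
move=> nz; split; apply: contrapT => out; case/eqP: nz.
  by rewrite /coef_at fr_gen_out // !linear0.
by rewrite /coef_at fr_coord_out.
Qed.

Lemma coef_atE t c a : I a t -> J c t -> coef_at t c a = coef c a.
Proof.
move=> It Jt; rewrite /coef; case: xgetP => [s _ [Is Js]|/(_ t)]; last first.
  by case; split.
have [st|/ltW ts] := leP s t; first exact: coef_at_le.
by rewrite (coef_at_le ts).
Qed.

(** A nonzero component forces the target to extend to the left of the source
    and the source to extend to the right of the target. *)
Lemma coef_neq0 c a : coef c a != 0 -> exists t,
  [/\ I a t, J c t, forall s, s <= t -> I a s -> J c s &
      forall s, t <= s -> J c s -> I a s].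
Proof.
rewrite /coef; set t := xget _ _ => nz; have [It Jt] := coef_at_neq0 nz.
exists t; split=> // s st.
  move=> Is; apply: (proj2 (coef_at_neq0 (a := a) _)).
  by rewrite -(coef_at_le st).
move=> Js; apply: (proj1 (coef_at_neq0 (c := c) _)).
by rewrite (coef_at_le st).
Qed.

End MorphismCoef.

Lemma coef_bounds (k : fieldType) (R : realType) (V W : pmod k R)
    (A C : choiceType) (I : A -> set R) (J : C -> set R)
    (FV : frame V I) (FW : frame W J) (f g : R -> R)
    (fle : {homo f : x y / x <= y}) (h : pmor V (preindex fle W)) c a :
  monotone_bijection f g ->
  coef FV (frame_preindex fle FW) h c a != 0 ->
  (birth (J c) <= er_map f (birth (I a)))%E /\
  (death (J c) <= er_map f (death (I a)))%E.
Proof.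
move=> fg /coef_neq0[t [It Jt IJ JI]]; split.
  by apply: (birth_le_map fg It).
exact: (death_le_map fg Jt).
Qed.

(** * Matching the long intervals *)

(** Only one of the two composition identities of an interleaving is needed to
    match all the long intervals of [V] to intervals of [W]. *)
Section HalfMatching.
Variables (k : fieldType) (R : realType) (V W : pmod k R).
Variables (A C : choiceType) (I : A -> set R) (J : C -> set R).
Variables (FV : frame V I) (FW : frame W J).
Hypothesis itvI : forall a, is_interval (I a).
Hypothesis itvJ : forall c, is_interval (J c).
Variables (tau taui sigma sigmai : R -> R).
Hypothesis tauK : monotone_bijection tau taui.
Hypothesis sigmaK : monotone_bijection sigma sigmai.
Variables (tle : {homo tau : x y / x <= y}).
Variables (sle : {homo sigma : x y / x <= y}).
Variables (phi : pmor V (preindex tle W)) (psi : pmor W (preindex sle V)).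
Hypothesis rho_ge : forall t, t <= sigma (tau t).
Hypothesis psi_phi : forall t (x : V t),
  psi (tau t) (phi t x) = pm_map V (rho_ge t) x.

Let rho := er_map (sigma \o tau).
Let b a := birth (I a).
Let d a := death (I a).
Let F := coef FV (frame_preindex tle FW) phi.
Let G := coef FW (frame_preindex sle FV) psi.

(** The intervals that have to be matched: those whose right endpoint lies beyond
    the shift of the left one. *)
Definition long (a : A) : Prop :=
  (er_map (sigma \o tau) (birth (I a)) < death (I a))%E.

(** The intervals [a] and [c] may be matched to each other. *)
Definition close (a : A) (c : C) : Prop :=
  [/\ (birth (J c) <= er_map tau (birth (I a)))%E,
      (birth (I a) <= er_map sigma (birth (J c)))%E,
      (death (J c) <= er_map tau (death (I a)))%E &
      (death (I a) <= er_map sigma (death (J c)))%E].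

Let rhoK : monotone_bijection (sigma \o tau) (taui \o sigmai).
Proof. exact: monotone_bijection_comp. Qed.

Let rho_mono : {mono rho : x y / (x <= y)%E}.
Proof. exact: er_map_le rhoK. Qed.

Let er_ge x : (x <= rho x)%E.
Proof. by case: x => [x||] //=; rewrite ?lee_fin ?leey ?leNye. Qed.

Let rhoE x : rho x = er_map sigma (er_map tau x).
Proof. exact: er_map_comp. Qed.

(* The strict order on the summands of [V] that makes the matrix triangular. *)
Let below a a' : Prop := shift_lt rho (b a, d a) (b a', d a').

Let below_birth a a' :
  (rho (b a) < b a')%E -> (d a <= rho (d a'))%E -> below a a'.
Proof. by move=> bb dd; exists 0%N, 1%N; split => //=; exact: ltW. Qed.

Let below_death a a' :
  (b a <= rho (b a'))%E -> (rho (d a) < d a')%E -> below a a'.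
Proof. by move=> bb dd; exists 1%N, 0%N; split => //=; exact: ltW. Qed.

Let below_both a a' : (b a < b a')%E -> (d a < d a')%E -> below a a'.
Proof. by move=> bb dd; exists 0%N, 0%N; split => //=; exact: ltW. Qed.

(** Components through a summand that is close to neither [a] nor [a'] only
    occur between summands that are strictly ordered. *)
Lemma far_below a a' c : F c a != 0 -> G a' c != 0 ->
  ~ close a c -> ~ close a' c -> below a' a.
Proof.
move=> /(coef_bounds tauK)[b1 d1] /(coef_bounds sigmaK)[b2 d2] nca nca'.
have [far|far] : (er_map sigma (birth (J c)) < b a)%E \/
    (er_map sigma (death (J c)) < d a)%E.
  rewrite !ltNge; apply/orP; rewrite -negb_and; apply/negP => /andP[? ?].
  exact: nca.
all: have [far'|far'] : (er_map tau (b a') < birth (J c))%E \/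
    (er_map tau (d a') < death (J c))%E
  by rewrite !ltNge; apply/orP; rewrite -negb_and; apply/negP => /andP[? ?];
     exact: nca'.
- apply: below_birth; rewrite rhoE.
    by apply: lt_trans far; rewrite (er_map_lt sigmaK).
  by apply: le_trans d2 _; rewrite (er_map_le sigmaK).
- apply: below_both; first exact: le_lt_trans far.
  by rewrite -(er_map_lt tauK); apply: lt_le_trans far' _.
- apply: below_both; last exact: le_lt_trans far.
  by rewrite -(er_map_lt tauK); apply: lt_le_trans far' _.
- apply: below_death; rewrite rhoE.
    by apply: le_trans b2 _; rewrite (er_map_le sigmaK).
  by apply: lt_trans far; rewrite (er_map_lt sigmaK).
Qed.

(** A parameter at which the shift has a component from [a] to [a']. *)
Lemma window a a' : (b a' <= rho (b a))%E -> (d a' <= rho (d a))%E ->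
  (rho (b a) < d a')%E -> exists2 t, I a t & I a' (sigma (tau t)).
Proof.
move=> bb dd; rewrite -(er_map_lt_swap _ _ rhoK).
case/exists_real_between => t /andP[bt td].
have {}td : ((sigma (tau t))%:E < d a')%E by move: td; rewrite (er_map_lt_swap _ _ rhoK).
have rbt : (rho (b a) < (sigma (tau t))%:E)%E.
  by rewrite -[(sigma _)%:E]/(rho t%:E) (er_map_lt rhoK).
exists t; apply: interval_between => //.
- by rewrite -(er_map_lt rhoK); apply: lt_le_trans dd.
- exact: le_lt_trans rbt.
Qed.

(** The relation [psi \o phi = shift], read on the components from [a] to
    [a']. *)
Lemma sum_coef a a' t : I a t -> I a' (sigma (tau t)) ->
  \sum_(c <- fr_idx FW (tau t)) G a' c * F c a = (a' == a)%:R.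
Proof.
move=> It It'.
have <- : fr_coord FV a' (sigma (tau t))
    (pm_map V (rho_ge t) (fr_gen FV a t)) = (a' == a)%:R.
  rewrite fr_gen_map //.
  case: (pselect (I a (sigma (tau t)))) => [Is|nIs]; first exact: fr_coord_gen.
  rewrite fr_gen_out // linear0; case: eqP => // aa'.
  by rewrite aa' in It'.
rewrite -psi_phi (fr_expand FW (phi t (fr_gen FV a t))) !linear_sum.
apply: eq_big_seq => c /fr_idxP Jc.
rewrite !linearZ /= mulrC; congr (_ * _).
  by rewrite /F -(coef_atE _ _ _ (t := t)).
by rewrite /G -(coef_atE _ _ _ (t := tau t)).
Qed.

(** If two consecutive components from [a] to [a'] through [c] do not vanish,
    then [c] is alive wherever [a] and the shift of [a'] are. *)
Lemma coef_middle a a' c t : I a t -> I a' (sigma (tau t)) ->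
  F c a != 0 -> G a' c != 0 -> J c (tau t).
Proof.
move=> It It' /coef_neq0[s [Is Js IJ _]] /coef_neq0[u [Ju Iu _ IJ']].
have [ts|/ltW st] := leP t s; first exact: IJ.
have [ut|/ltW tu] := leP u (tau t); first exact: IJ'.
by apply: (itvJ Js Ju); rewrite tu tle.
Qed.

(** Only the summands close to [a] or [a'] are needed in the composition, unless
    [a'] is strictly below [a]: the matrix product is triangular. *)
Lemma sum_coef_close a a' (N : {fset C}) :
  long a -> long a' -> (forall c, close a c \/ close a' c -> c \in N) ->
  ~ below a' a -> \sum_(c <- N) G a' c * F c a = (a' == a)%:R.
Proof.
move=> la la' Nclose nbelow.
have outN c : c \notin N -> G a' c * F c a = 0.
  move=> cN; apply/eqP; rewrite mulf_eq0; apply/negPn/negP.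
  rewrite negb_or => /andP[Gc Fc]; apply: nbelow.
  by apply: (far_below Fc Gc) => cl; move/negP: cN; apply; apply: Nclose; auto.
case: (pselect (exists2 t, I a t & I a' (sigma (tau t)))) => [[t It It']|nw].
  rewrite -(sum_coef It It'); set S := fr_idx FW (tau t).
  have outS c : c \notin S -> G a' c * F c a = 0.
    move=> cS; apply/eqP; rewrite mulf_eq0; apply/negPn/negP.
    rewrite negb_or => /andP[Gc Fc]; move/negP: cS; apply.
    by apply/fr_idxP; exact: coef_middle Fc Gc.
  rewrite (big_fset_incl _ (fsubsetUl N S)); last by move=> c _; exact: outN.
  rewrite -(big_fset_incl _ (fsubsetUr N S)) // => c _; exact: outS.
have -> : (a' == a) = false.
  apply/eqP => e; subst a'; apply: nw; apply: window => //; exact: er_ge.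
apply: big1_seq => c _; apply/eqP; rewrite mulf_eq0; apply/negPn/negP.
rewrite negb_or => /andP[/(coef_bounds sigmaK)[b2 d2] /(coef_bounds tauK)[b1 d1]].
have bb : (b a' <= rho (b a))%E.
  by apply: le_trans b2 _; rewrite rhoE (er_map_le sigmaK).
have dd : (d a' <= rho (d a))%E.
  by apply: le_trans d2 _; rewrite rhoE (er_map_le sigmaK).
have [lt|ge] := ltP (rho (b a)) (d a'); first exact/nw/window.
apply: nbelow; apply: below_both; last exact: le_lt_trans ge la.
by rewrite -(er_map_lt rhoK); exact: lt_le_trans la' ge.
Qed.

(** All intervals close to a long one contain a common parameter, and only
    finitely many summands are alive there. *)
Lemma close_finite a : long a -> finite_set [set c | close a c].
Proof.
move=> la; have : (er_map tau (b a) < er_map sigmai (d a))%E.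
  by rewrite (er_map_lt_swap _ _ sigmaK) -rhoE.
case/exists_real_between => t /andP[bt td].
apply: sub_finite_set (finite_fset (fr_idx FW t)) => c [b1 b2 d1 d2] /=.
apply/fr_idxP/(interval_between (@itvJ c)); first exact: le_lt_trans bt.
apply: lt_le_trans td _.
by rewrite (er_map_le_swap _ _ sigmaK).
Qed.

Let nbrs a : {fset C} := fset_set [set c | close a c].

Let nbrsP a c : long a -> (c \in nbrs a) = `[< close a c >].
Proof.
move=> la; rewrite in_fset_set; last exact: close_finite.
by apply/idP/asboolP => [/set_mem|/mem_set].
Qed.

(** With fewer neighbours than vertices, some nonzero combination [x] of the
    columns of [F] vanishes on the neighbours; the row of [G * F] at a maximal
    element of the support of [x] is then contradictory. *)
Lemma close_hall : hall_condition long nbrs.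
Proof.
move=> K Klong; rewrite leqNgt; apply/negP => lt.
have [x [[a0 a0K xa0] xsol]] := nonzero_solution F (fset_uniq K) lt.
pose S := [seq a <- enum_fset K | x a != 0].
have a0S : a0 \in S by rewrite mem_filter xa0.
have [m] := exists_maximal (r := below) (fun a => @shift_lt_irr _ _ _ er_ge _)
  (fun p q r => @shift_lt_trans _ _ _ rho_mono _ _ _) a0S.
rewrite mem_filter => /andP[xm mK] mmax; move/eqP: xm; apply.
have row a : a \in K ->
    \sum_(c <- nbhds nbrs K) G m c * (x a * F c a) = x a * (m == a)%:R.
  move=> aK; under eq_bigr do rewrite mulrCA.
  rewrite -mulr_sumr; have [->|xa] := eqVneq (x a) 0; first by rewrite !mul0r.
  rewrite sum_coef_close //; try exact: Klong.
    by move=> c [] cl; apply/nbhdsP; [exists a|exists m] => //;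
      rewrite nbrsP; [exact/asboolP|exact: Klong|exact/asboolP|exact: Klong].
  by apply: mmax; rewrite mem_filter xa.
have : \sum_(c <- nbhds nbrs K) G m c * (\sum_(a <- K) x a * F c a) = 0.
  by apply: big1_seq => c /andP[_ cN]; rewrite xsol ?mulr0.
under eq_bigr do rewrite mulr_sumr.
rewrite exchange_big /= (eq_big_seq _ row) (big_fsetD1 m) //= eqxx mulr1.
rewrite big1_seq ?addr0 // => a; rewrite !inE => /andP[_ /andP[am _]].
by rewrite eq_sym (negbTE am) mulr0.
Qed.

Lemma half_matching : exists M : A -> C -> Prop,
  [/\ partial_injection M, forall a c, M a c -> close a c &
      forall a, long a -> exists c, M a c].
Proof.
have [M [injM Mclose Mlong]] := hall_matching close_hall.
exists M; split => // a c /Mclose[la].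
by rewrite nbrsP // => /asboolP.
Qed.

End HalfMatching.

(** * The frame of an interval decomposition *)

(** At [t] the interval module of [J] is the space of row vectors of length 1 or
    0, according to whether [t] lies in [J]. *)
Section RowVectorsOfBooleanLength.
Variable k : fieldType.
Implicit Types n m : bool.

(** The only entry of a row vector of length 1, and 0 for the empty vector. *)
Definition entry n (x : 'rV[k]_n) : k := \sum_i x 0 i.

Lemma entry_linear n c (x y : 'rV[k]_n) :
  entry (c *: x + y) = c * entry x + entry y.
Proof.
rewrite /entry mulr_sumr -big_split /=; apply: eq_bigr => i _.
by rewrite !mxE.
Qed.

Lemma entry_pid n m (x : 'rV[k]_n) :
  m -> entry (x *m (pid_mx 1 : 'M_(n, m))) = entry x.
Proof.
case: m n x => // -[] x _; first by rewrite pid_mx_1 mulmx1.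
rewrite /entry big_ord0; apply: big1 => i _.
by rewrite mxE big_ord0.
Qed.

Lemma const_pid n m (c : k) : n || (c == 0) ->
  (const_mx c : 'rV_n) *m (pid_mx 1 : 'M_(n, m)) = const_mx c.
Proof.
case: n m => -[] /= => [_|_|/eqP ->|_]; last 1 first.
- by apply/matrixP => ? -[].
- by rewrite pid_mx_1 mulmx1.
- by apply/matrixP => ? -[].
- by apply/matrixP => i j; rewrite !mxE big_ord0.
Qed.

Lemma entry_const n (c : k) : n || (c == 0) -> entry (const_mx c : 'rV_n) = c.
Proof.
by case: n => /= [_|/eqP ->]; rewrite /entry ?big_ord1 ?big_ord0 ?mxE.
Qed.

Lemma empty_row_eq n (x y : 'rV[k]_n) : ~~ n -> x = y.
Proof. by case: n x y => // x y _; apply/matrixP => i []. Qed.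

Lemma entryK n (x : 'rV[k]_n) : x = const_mx (entry x).
Proof.
apply/matrixP => i j; rewrite ord1 mxE.
by case: n x j => x [] // [|//] lt; rewrite /entry big_ord1; congr (x _ _); apply: val_inj.
Qed.

End RowVectorsOfBooleanLength.

Lemma dsum_sumE (k : fieldType) (A : Type) (M : A -> lmodType k)
    (T : eqType) (s : seq T) (F : T -> dsum M) (a : A) :
  (\sum_(i <- s) F i) a = \sum_(i <- s) F i a.
Proof. by apply: (big_morph (fun f : dsum M => f a)). Qed.

Section DecompositionFrame.
Variables (k : fieldType) (R : realType) (V : pmod k R).
Variables (A : choiceType) (J : A -> ninterval R).
Let D := direct_sum (fun a => interval_mod k (J a)).
Variables (f : pmor V D) (g : pmor D V).
Hypotheses (fK : forall t, cancel (f t) (g t)).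
Hypotheses (gK : forall t, cancel (g t) (f t)).
Hypothesis V_pfd : pfd V.

(** The component of [x] in the summand [a], and its value as a scalar. *)
Definition component (a : A) (t : R) (x : D t) : 'rV[k]_(t \in (J a : set R)) :=
  (x : dsum (fun a => interval_mod k (J a) t)) a.

Definition coordinate (a : A) (t : R) (x : V t) : k^o := entry (component a (f t x)).

Lemma coord_linear a t : linear (@coordinate a t).
Proof.
by move=> c x y; rewrite /coordinate linearP -entry_linear.
Qed.
HB.instance Definition _ a t :=
  GRing.isLinear.Build k (V t) k^o _ (@coordinate a t) (@coord_linear a t).

(** The generator of the summand [a] in the direct sum; at parameters outside
    [J a] its only possibly nonzero component is an empty vector. *)
Definition unit_fun (a : A) (t : R) : forall a', interval_mod k (J a') t :=
  fun a' => (const_mx (a' == a)%:R : 'rV[k]_(t \in (J a' : set R))).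

Lemma unit_fin a t : finite_set [set a' | unit_fun a t a' <> 0].
Proof.
apply: sub_finite_set (finite_set1 a) => a' /=; apply: contra_notP.
move=> /eqP/negbTE e; rewrite /unit_fun e.
by apply/matrixP => i j; rewrite !mxE.
Qed.

Definition unit_sum a t : D t := Dsum (@unit_fin a t).

Definition gen a t : V t := g t (unit_sum a t).

Lemma unit_out a t : ~ (J a : set R) t -> unit_sum a t = 0.
Proof.
move=> nJ; apply: dsumP => a' /=; rewrite /unit_fun.
have [->|_] := eqVneq a' a; last by apply/matrixP => i j; rewrite !mxE.
by apply: empty_row_eq; rewrite memNset.
Qed.

Lemma gen_out a t : ~ (J a : set R) t -> gen a t = 0.
Proof. by move=> /unit_out e; rewrite /gen e linear0. Qed.

Lemma coord_out a t (x : V t) : ~ (J a : set R) t -> coordinate a x = 0 :> k^o.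
Proof.
move=> nJ; have e : component a (f t x) = 0 by apply: empty_row_eq; rewrite memNset.
by rewrite /coordinate e; apply: big1 => i _; rewrite mxE.
Qed.

Lemma gen_map a s t (st : s <= t) : (J a : set R) s ->
  pm_map V st (gen a s) = gen a t.
Proof.
move=> /mem_set Js; rewrite /gen -pmor_nat; congr (g t _).
apply: dsumP => a' /=; apply: const_pid.
by have [->|_] := eqVneq a' a; rewrite ?Js ?eqxx ?orbT.
Qed.

Lemma coord_map a s t (st : s <= t) (x : V s) : (J a : set R) t ->
  coordinate a (pm_map V st x) = coordinate a x.
Proof.
move=> /mem_set Jt; rewrite /coordinate pmor_nat.
exact: entry_pid.
Qed.

Lemma coord_gen a a' t : (J a : set R) t ->
  coordinate a' (gen a t) = (a' == a)%:R :> k^o.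
Proof.
move=> /mem_set Jt; rewrite /coordinate /gen gK /component /= /unit_fun.
apply: entry_const.
by have [->|_] := eqVneq a' a; rewrite ?Jt ?eqxx ?orbT.
Qed.

(** The generators alive at [t] are linearly independent, so there are finitely
    many of them. *)
Lemma alive_finite t : finite_set [set a | (J a : set R) t].
Proof.
apply: contrapT => inf; have [n [b bP]] := V_pfd t.
have [c cE] := choice (fun a => bP (gen a t)).
have [K KJ cardK] := infinite_set_fset n.+1 inf.
have [|x [[a0 a0K xa0] xsol]] :=
    nonzero_solution (N := enum 'I_n) (fun i a => c a i) (fset_uniq K).
  by rewrite size_enum_ord.
have : \sum_(a <- K) x a *: gen a t = 0.
  under eq_bigr do rewrite cE scaler_sumr.
  rewrite exchange_big /=; apply: big1 => i _.
  under eq_bigr do rewrite scalerA.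
  by rewrite -scaler_suml xsol ?scale0r // mem_enum.
move=> /(congr1 (@coordinate a0 t)); rewrite linear0 linear_sum /=.
rewrite (big_fsetD1 a0) //= big1_seq => [|a].
  rewrite addr0 linearZ /= coord_gen ?eqxx; last exact: KJ.
  by rewrite [_ *: _]mulr1; exact/eqP.
rewrite !inE => /andP[_ /andP[aa0 aK]]; rewrite linearZ /= coord_gen; last exact: KJ.
by rewrite eq_sym (negbTE aa0) scaler0.
Qed.

Definition idx t : {fset A} := fset_set [set a | (J a : set R) t].

Lemma idxP a t : a \in idx t <-> (J a : set R) t.
Proof.
rewrite /idx in_fset_set; last exact: alive_finite.
by split => [/set_mem|/mem_set].
Qed.

Lemma expand t x : x = \sum_(a <- idx t) coordinate a x *: gen a t.
Proof.
(* Compare the images in the direct sum, one component at a time. *)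
apply: (can_inj (fK (t := t))); rewrite linear_sum.
apply: dsumP => a; rewrite dsum_sumE.
under eq_bigr do rewrite linearZ /gen gK /=.
have comp0 : ~ (J a : set R) t -> forall y z : 'rV[k]_(t \in (J a : set R)), y = z.
  by move=> nJ y z; apply: empty_row_eq; rewrite memNset.
case: (pselect (a \in idx t)) => [aS|/(contra_not (proj2 (idxP a t)))]; last first.
  by move=> /comp0; apply.
rewrite (big_fsetD1 a) //= big1_seq => [|a'].
  rewrite addr0 /unit_fun eqxx.
  rewrite [LHS](entryK (component a (f t x))) -/(coordinate a x).
  by apply/matrixP => i j; rewrite !mxE mulr1.
rewrite !inE => /andP[_ /andP[aa' _]].
rewrite /unit_fun eq_sym (negbTE aa').
by apply/matrixP => i j; rewrite !mxE mulr0.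
Qed.

Definition decomposition_frame : frame V (fun a => J a : set R) :=
  @Frame k R V A (fun a => J a : set R) gen coordinate idx
    gen_map coord_map coord_gen idxP expand gen_out coord_out.

End DecompositionFrame.

(** * Matchings of persistence diagrams *)

Lemma matching_of_relation (R : realType) (S T : set (dpoint R))
    (X : set (dpoint R * dpoint R)) :
  (forall s t, X (s, t) -> S s /\ T t) ->
  (forall s t t', X (s, t) -> X (s, t') -> t = t') ->
  (forall s s' t, X (s, t) -> X (s', t) -> s = s') ->
  matching S T X.
Proof.
move=> XST fun_X inj_X; pose f s := xget s [set t | X (s, t)].
have fP s t : X (s, t) -> X (s, f s).
  by move=> Xst; apply: (xgetPex s (P := [set t | X (s, t)])); exists t.
exists (matching_dom X), T, f; split.
- by move=> s [t /XST[]].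
- by [].
- by move=> s [t /fP/XST[]].
- move=> s s' /set_mem[t /fP Xs] /set_mem[t' /fP Xs'] e.
  by apply: inj_X Xs _; rewrite e.
- apply/seteqP; split=> [[s t] Xst|[s t] /= [[t' /fP Xs] <- //]].
  by split; [exists t|exact: fun_X (fP _ _ Xst) Xst].
Qed.

Lemma persistence_diagram_frame (k : fieldType) (R : realType) (V : pmod k R)
    (D : set (dpoint R)) :
  pfd V -> persistence_diagram V D ->
  exists (A : choiceType) (I : A -> set R) (F : frame V I) (e : A -> dpoint R),
    [/\ forall a, is_interval (I a), forall a, D (e a), injective e,
        forall q, D q -> exists a, e a = q &
        forall a, (e a).1 = (birth (I a), death (I a))].
Proof.
move=> V_pfd [_ [A [J [e [[f [g [fK gK]]] [eD e_inj e_surj] eE]]]]].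
exists {classic A}, (fun a => J a : set R).
exists (decomposition_frame (A := {classic A}) fK gK V_pfd), e; split => //.
- by move=> a; exact: ni_interval.
- by move=> a; exact: eD.
- by move=> a a'; apply: e_inj; exact: mem_set.
- by move=> q /e_surj[a _ <-]; exists a.
Qed.

Unset Implicit Arguments.

Theorem corollary4p9 (k : fieldType) (R : realType) (V W : pmod k R)
  (V_pfd : pfd V) (W_pfd : pfd W)
  (tau sigma : R -> R) (p : translation_pair tau sigma)
  (VW : interleaved p V W)
  (tau_bij : bijective tau)
  (sigma_inv : R -> R)
  (sigmaK : cancel sigma sigma_inv) (sigma_invK : cancel sigma_inv sigma)
  (PDV PDW : set (dpoint R))
  (PDV_V : persistence_diagram V PDV) (PDW_W : persistence_diagram W PDW) :
  exists X : set (dpoint R * dpoint R),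
    [/\ matching PDV PDW X,
        forall (b d b' d' : \bar R) (i i' : nat),
          X ((b, d, i), (b', d', i')) ->
          (er_map sigma_inv b <= b' <= er_map tau b)%E /\
          (er_map sigma_inv d <= d' <= er_map tau d)%E,
        forall (b d : \bar R) (i : nat),
          PDV (b, d, i) -> ~ matching_dom X (b, d, i) ->
          (d <= er_map (sigma \o tau) b)%E &
        forall (b' d' : \bar R) (i' : nat),
          PDW (b', d', i') -> ~ matching_im X (b', d', i') ->
          (d' <= er_map (tau \o sigma) b')%E].
Proof.
have [tau_inv tauK tau_invK] := tau_bij.
have tauB : monotone_bijection tau tau_inv by split => //; exact: tp_mono1 p.
have sigmaB : monotone_bijection sigma sigma_inv by split => //; exact: tp_mono2 p.
have [A [I [FV [e [itvI eD e_inj e_surj eE]]]]] :=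
  persistence_diagram_frame V_pfd PDV_V.
have [C [J [FW [e' [itvJ eD' e_inj' e_surj' eE']]]]] :=
  persistence_diagram_frame W_pfd PDW_W.
have [phi [psi [psi_phi phi_psi]]] := VW.
have [f [f_inj f_close f_long]] :=
  half_matching FV FW itvI itvJ tauB sigmaB psi_phi.
have [g [g_inj g_close g_long]] :=
  half_matching FW FV itvJ itvI sigmaB tauB phi_psi.
have [M1 M2] := merge_injection f_inj g_inj.
have M_close a c : merge f g a c -> close I J tau sigma a c.
  by move=> [[_ /f_close //]|[_ /g_close[]]]; split.
exists [set st | exists a c, [/\ merge f g a c, e a = st.1 & e' c = st.2]].
split.
- apply: matching_of_relation.
  + by move=> s t [a [c [_ /= <- <-]]].
  + move=> s t t' [a [c [Mac /= <- <-]]] [a' [c' [Mac' /= /e_inj ea <-]]].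
    by rewrite ea in Mac'; rewrite (M1 _ _ _ Mac Mac').
  + move=> s s' t [a [c [Mac /= <- <-]]] [a' [c' [Mac' /= <- /e_inj' ec]]].
    by rewrite ec in Mac'; rewrite (M2 _ _ _ Mac Mac').
- move=> b d b' d' i i' [a [c [/M_close[bJ bI dJ dI] /= ea ec]]].
  have := eE a; rewrite ea => -[-> ->]; have := eE' c; rewrite ec => -[-> ->].
  by rewrite !(er_map_le_swap _ _ sigmaB) bJ bI dJ dI.
- move=> b d i /e_surj[a ea] unmatched; rewrite leNgt; apply/negP => lt.
  have [c fac] : exists c, f a c.
    by apply: f_long; have := eE a; rewrite ea /long => -[<- <-].
  have [c' Mac'] := merge_covers_left g fac; apply: unmatched; exists (e' c').
  by exists a, c'.
- move=> b d i /e_surj'[c ec] unmatched; rewrite leNgt; apply/negP => lt.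
  have [a gca] : exists a, g c a.
    by apply: g_long; have := eE' c; rewrite ec /long => -[<- <-].
  have [a' Mac'] := merge_covers_right f g_inj gca.
  by apply: unmatched; exists (e a'), a', c.
Qed.
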